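(* Let $f:\mathbb{R}^n\to\mathbb{R}$, $x_0\in\mathbb{R}^n$ and $\delta_{\max}>0$ be such that $f$ is continuously differentiable in an open set containing $L_{enl}(x_0)$, $\nabla f$ is Lipschitz continuous on $L_{enl}(x_0)$ with constant $\kappa_{Lg}$, and $f$ is bounded from below on $L(x_0)$. Let $\{m_k\}$, $\{x_k\}$, $\{\delta_k\}$, $\{s_k\}$ be any sequences of quadratic models, iterates, trust-region radii and steps generated by the first order trust-region algorithm described in the context (any realization of the algorithm), with every step $s_k$ achieving a fraction of Cauchy decrease with the same constant $\kappa_{fcd}\in(0,1]$, and with $\|H_k\|\le\kappa_{bhm}$ for all $k$, for some constant $\kappa_{bhm}>0$. Then $$\lim_{k\to\infty}\delta_k \;=\; 0 .$$
   Context: Notation: $\|\cdot\|$ is the Euclidean norm for vectors and the induced norm for matrices; $B(x,\delta)$ is the closed ball of center $x$ and radius $\delta$. $L(x_0)=\{x\in\mathbb{R}^n: f(x)\le f(x_0)\}$ and $L_{enl}(x_0)=\bigcup_{x\in L(x_0)}B(x,\delta_{\max})$. Models: at iteration $k$ the model is a quadratic function written as $m_k(x_k+s)=m_k(x_k)+s^\top g_k+\frac12 s^\top H_k s$, with $g_k=\nabla m_k(x_k)$ and $H_k=\nabla^2 m_k(x_k)$ symmetric. No relation between $m_k$ and $f$ is assumed. Fraction of Cauchy decrease: the step $s_k\in B(0,\delta_k)$ satisfies $$m_k(x_k)-m_k(x_k+s_k)\ \ge\ \frac{\kappa_{fcd}}{2}\|g_k\|\min\left\{\frac{\|g_k\|}{\|H_k\|},\delta_k\right\},$$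 where the ratio is interpreted as $+\infty$ if $H_k=0$. First order trust-region algorithm: fix parameters $\eta_1,\eta_2,\gamma,\delta_{\max}>0$ with $\gamma>1$, a starting point $x_0$ and an initial radius $0<\delta_0\le\delta_{\max}$. At iteration $k=0,1,2,\dots$, a model $m_k$ of $f$ in $B(x_k,\delta_k)$ is given, and a step $s_k\in B(0,\delta_k)$ achieving a fraction of Cauchy decrease is computed. Let $$\rho_k=\frac{f(x_k)-f(x_k+s_k)}{m_k(x_k)-m_k(x_k+s_k)}.$$ If $\rho_k\ge\eta_1$ and $\|g_k\|\ge\eta_2\delta_k$, set $x_{k+1}=x_k+s_k$ and $\delta_{k+1}=\min\{\gamma\delta_k,\delta_{\max}\}$. Otherwise set $x_{k+1}=x_k$ and $\delta_{k+1}=\gamma^{-1}\delta_k$. (If $g_k=0$, the second condition fails, so the value of $\rho_k$ is irrelevant.) *)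

(* Defs.v *)
From mathcomp Require Import all_boot all_order all_algebra.
From mathcomp Require Import all_classical all_reals all_analysis.
Set Implicit Arguments.
Unset Strict Implicit.
Unset Printing Implicit Defensive.
Import Order.TTheory GRing.Theory Num.Theory numFieldNormedType.Exports.
Local Open Scope classical_set_scope.
Local Open Scope ring_scope.

Definition dot (R : realType) (n : nat) (u v : 'cV[R]_n) : R :=
  \sum_(i < n) u i 0 * v i 0.

(* The library norm on matrices is the max norm, hence these two norms.  Both
   norms of vectors induce the same topology, so the library's [open],
   [differentiable] and [continuous] on 'cV[R]_n have their usual meaning. *)
Definition enorm (R : realType) (n : nat) (u : 'cV[R]_n) : R :=
  Num.sqrt (dot u u).

Definition opnorm (R : realType) (n : nat) (A : 'M[R]_n) : R :=
  sup [set enorm (A *m u) | u in [set u : 'cV[R]_n | enorm u <= 1]].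

Definition eball (R : realType) (n : nat) (x : 'cV[R]_n) (r : R) :
    set 'cV[R]_n :=
  [set y | enorm (y - x) <= r].

Definition partial (R : realType) (n : nat) (i : 'I_n) (f : 'cV[R]_n -> R) :
    'cV[R]_n -> R :=
  fun x => 'D_(delta_mx i 0) f x.

Definition gradient (R : realType) (n : nat) (f : 'cV[R]_n -> R)
    (x : 'cV[R]_n) : 'cV[R]_n :=
  \col_i partial i f x.

Definition hessian (R : realType) (n : nat) (f : 'cV[R]_n -> R)
    (x : 'cV[R]_n) : 'M[R]_n :=
  \matrix_(i, j) partial i (partial j f) x.

Definition C1_on (R : realType) (n : nat) (f : 'cV[R]_n -> R)
    (U : set 'cV[R]_n) : Prop :=
  forall x, U x -> differentiable f x /\ {for x, continuous (gradient f)}.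

Definition level_set (R : realType) (n : nat) (f : 'cV[R]_n -> R)
    (x0 : 'cV[R]_n) : set 'cV[R]_n :=
  [set x | f x <= f x0].

Definition enlarged_level_set (R : realType) (n : nat) (f : 'cV[R]_n -> R)
    (x0 : 'cV[R]_n) (dmax : R) : set 'cV[R]_n :=
  \bigcup_(x in level_set f x0) eball x dmax.

Definition elipschitz_on (R : realType) (n : nat) (F : 'cV[R]_n -> 'cV[R]_n)
    (A : set 'cV[R]_n) (L : R) : Prop :=
  forall x y, A x -> A y -> enorm (F x - F y) <= L * enorm (x - y).

(* [m] equals its second-order Taylor expansion at [x], i.e. it is a polynomial
   of degree at most 2. *)
Definition quadratic_model (R : realType) (n : nat) (m : 'cV[R]_n -> R)
    (x : 'cV[R]_n) : Prop :=
  (hessian m x)^T = hessian m x /\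
  forall s, m (x + s) =
    m x + dot s (gradient m x) + 2^-1 * dot s (hessian m x *m s).

(* The [if] encodes the convention that the ratio is +oo when the Hessian is 0
   (in the library, division by 0 returns 0). *)
Definition cauchy_decrease (R : realType) (n : nat) (kfcd : R)
    (m : 'cV[R]_n -> R) (x : 'cV[R]_n) (delta : R) (s : 'cV[R]_n) : Prop :=
  let g := gradient m x in
  let H := hessian m x in
  kfcd / 2 * enorm g *
    (if H == 0 then delta else Num.min (enorm g / opnorm H) delta)
  <= m x - m (x + s).

Definition rho (R : realType) (n : nat) (f m : 'cV[R]_n -> R)
    (x s : 'cV[R]_n) : R :=
  (f x - f (x + s)) / (m x - m (x + s)).

Definition successful (R : realType) (n : nat) (eta1 eta2 : R)
    (f m : 'cV[R]_n -> R) (x : 'cV[R]_n) (delta : R) (s : 'cV[R]_n) : bool :=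
  (eta1 <= rho f m x s) && (eta2 * delta <= enorm (gradient m x)).

Record trust_region_run (R : realType) (n : nat) (f : 'cV[R]_n -> R)
    (eta1 eta2 gamma dmax kfcd : R) (x0 : 'cV[R]_n) (delta0 : R)
    (m : nat -> 'cV[R]_n -> R) (x : nat -> 'cV[R]_n) (delta : nat -> R)
    (s : nat -> 'cV[R]_n) : Prop := TrustRegionRun {
  run_x0 : x 0%N = x0;
  run_delta0 : delta 0%N = delta0;
  run_model : forall k, quadratic_model (m k) (x k);
  run_step : forall k, eball 0 (delta k) (s k);
  run_decrease : forall k, cauchy_decrease kfcd (m k) (x k) (delta k) (s k);
  run_next_x : forall k, x k.+1 =
    if successful eta1 eta2 f (m k) (x k) (delta k) (s k)
    then x k + s k else x k;
  run_next_delta : forall k, delta k.+1 =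
    if successful eta1 eta2 f (m k) (x k) (delta k) (s k)
    then Num.min (gamma * delta k) dmax else gamma^-1 * delta k
}.

(* Main.v *)
Require Import Defs.
From mathcomp Require Import all_boot all_order all_algebra.
From mathcomp Require Import all_classical all_reals all_analysis.
From mathcomp Require Import ring lra.
Import Order.TTheory GRing.Theory Num.Theory numFieldNormedType.Exports.
Local Open Scope classical_set_scope.
Local Open Scope ring_scope.

(** Each iteration pays for its radius with a decrease of a potential.  When
    the step is accepted, the fraction of Cauchy decrease, the test
    [|g_k| >= eta2 delta_k] and the bound on the Hessians make the model, hence
    also [f], decrease by at least [c delta_k ^ 2] for a constant [c > 0]
    (lemma [successful_decrease]).  When it is rejected, [f] does not change
    but the radius shrinks by the factor [gamma^-1].  Therefore the potential
    [f (x_k) + a delta_k ^ 2] decreases by a fixed multiple of [delta_k ^ 2] in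
    both cases, provided that the weight [a] is small enough for the decrease
    of [f] to outweigh the possible growth of the radius to [gamma delta_k].
    Since [f] decreases along the iterates, these stay in the level set of
    [x_0], where [f] is bounded below; so the potential is bounded below, the
    series of the [delta_k ^ 2] converges (lemma [cvg0_of_potential]), and
    [delta_k] tends to 0. *)

Section Norms.
Context {R : realType} {n : nat}.

Lemma dot_self_ge0 (u : 'cV[R]_n) : 0 <= dot u u.
Proof. by apply: sumr_ge0 => i _; rewrite -expr2 sqr_ge0. Qed.

Lemma enorm_ge0 (u : 'cV[R]_n) : 0 <= enorm u.
Proof. exact: sqrtr_ge0. Qed.

Lemma norm_coord_le_enorm (u : 'cV[R]_n) (i : 'I_n) : `|u i 0| <= enorm u.
Proof.
rewrite -sqrtr_sqr ler_wsqrtr // /dot (bigD1 i) //= -expr2 lerDl.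
by apply: sumr_ge0 => j _; rewrite -expr2 sqr_ge0.
Qed.

Lemma enorm_delta_mx (j : 'I_n) : enorm (delta_mx j 0 : 'cV[R]_n) = 1.
Proof.
rewrite /enorm /dot (bigD1 j) //= big1 => [|i ij]; rewrite !mxE.
  by rewrite !eqxx mulr1 addr0 sqrtr1.
by rewrite (negbTE ij) mul0r.
Qed.

(** Since [sup] is 0 on unbounded sets, [opnorm] bounds anything only once its
    defining set is known to be bounded; the entries of [A] give a crude bound
    on the unit ball. *)
Lemma enorm_mulmx_le_opnorm (A : 'M[R]_n) (u : 'cV[R]_n) :
  enorm u <= 1 -> enorm (A *m u) <= opnorm A.
Proof.
move=> u1; apply: ub_le_sup; last by exists u.
exists (Num.sqrt (\sum_i (\sum_j `|A i j|) ^+ 2)) => _ [v v1 <-].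
rewrite ler_wsqrtr // /dot; apply: ler_sum => i _.
rewrite -expr2 -real_normK ?num_real // lerXn2r ?nnegrE ?sumr_ge0 //.
rewrite mxE (le_trans (ler_norm_sum _ _ _)) //; apply: ler_sum => j _.
by rewrite normrM ler_piMr // (le_trans (norm_coord_le_enorm _ _)).
Qed.

Lemma opnorm_gt0 (A : 'M[R]_n) : A != 0 -> 0 < opnorm A.
Proof.
case/matrix0Pn => i [j Aij]; rewrite -normr_gt0 in Aij.
apply: (lt_le_trans Aij).
apply: le_trans (enorm_mulmx_le_opnorm A (delta_mx j 0) _).
  by apply: le_trans (norm_coord_le_enorm _ i); rewrite -colE mxE.
by rewrite enorm_delta_mx.
Qed.

End Norms.

(** In the Cauchy bound both arguments of the minimum are at least a fixed
    multiple of [delta], and so is [|g|]: this is where the square of the radius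
    comes from.  The model decrease is positive because its ratio to the
    decrease of [f] is at least [eta1 > 0], a ratio with denominator 0 being
    0. *)
Lemma successful_decrease (R : realType) (n : nat) (f m : 'cV[R]_n -> R)
    (eta1 eta2 kfcd kbhm delta : R) (x s : 'cV[R]_n) :
  0 < eta1 -> 0 < eta2 -> 0 < kfcd -> 0 < kbhm -> 0 < delta ->
  cauchy_decrease kfcd m x delta s -> opnorm (hessian m x) <= kbhm ->
  successful eta1 eta2 f m x delta s ->
  eta1 * (kfcd / 2 * eta2 * Num.min (eta2 / kbhm) 1) * delta ^+ 2
    <= f x - f (x + s).
Proof.
move=> eta1_gt0 eta2_gt0 kfcd_gt0 kbhm_gt0 d_gt0 + Hle /andP[rho_ge g_ge].
rewrite /cauchy_decrease /=.
set g := enorm _ in g_ge *; set q := (if _ then _ else _).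
set mu := Num.min _ _ => dec.
have mu_gt0 : 0 < mu by rewrite lt_min ltr01 divr_gt0.
have q_ge : mu * delta <= q.
  have mud : mu * delta <= delta.
    by rewrite ler_piMl ?(ltW d_gt0) // ge_min lexx orbT.
  rewrite /q; case: ifPn => // /opnorm_gt0 H_gt0; rewrite le_min mud andbT.
  rewrite ler_pdivlMr // (le_trans _ g_ge) //.
  apply: (@le_trans _ _ (eta2 / kbhm * delta * kbhm)).
    rewrite ler_pM ?mulr_ge0 ?(ltW mu_gt0) ?(ltW d_gt0) ?(ltW H_gt0) //.
    by rewrite ler_wpM2r ?(ltW d_gt0) // ge_min lexx.
  by rewrite mulrAC divfK ?gt_eqF.
have mdec : kfcd / 2 * eta2 * mu * delta ^+ 2 <= m x - m (x + s).
  apply: le_trans dec.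
  have -> : kfcd / 2 * eta2 * mu * delta ^+ 2
    = kfcd / 2 * (eta2 * delta) * (mu * delta) by ring.
  have kg : 0 <= kfcd / 2 * (eta2 * delta) by rewrite ltW // !mulr_gt0.
  apply: ler_pM => //; first by rewrite ltW // mulr_gt0.
  by rewrite ler_wpM2l // divr_ge0 // ltW.
have m_gt0 : 0 < m x - m (x + s).
  by apply: lt_le_trans mdec; rewrite !mulr_gt0 ?exprn_gt0.
move: rho_ge; rewrite /rho ler_pdivlMr //; apply: le_trans.
by rewrite -mulrA ler_wpM2l // ltW.
Qed.

(** Telescoping bounds the partial sums of the series of the [d k ^+ 2]. *)
Lemma cvg0_of_potential {R : realType} (phi d : nat -> R) (e M : R) :
  0 < e -> (forall k, 0 <= d k) -> (forall k, M <= phi k) ->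
  (forall k, e * d k ^+ 2 <= phi k - phi k.+1) ->
  d @ \oo --> (0 : R).
Proof.
move=> e_gt0 d_ge0 phi_ge dec.
have sum_le N : e * series (fun k => d k ^+ 2) N <= phi 0%N - phi N.
  elim: N => [|N IH]; first by rewrite /series /= big_geq // mulr0 subrr.
  rewrite /series /= big_nat_recr //= mulrDr.
  by move: IH (dec N); rewrite /series /=; lra.
have : (fun k => d k ^+ 2) @ \oo --> (0 : R).
  apply/cvg_series_cvg_0/nondecreasing_is_cvgn.
    by apply/nondecreasing_series => k _ _; exact: sqr_ge0.
  exists ((phi 0%N - M) / e) => _ [N _ <-].
  rewrite ler_pdivlMr // mulrC (le_trans (sum_le N)) //.
  by have := phi_ge N; lra.
move=> /(continuous_cvg _ (@sqrt_continuous R 0)); rewrite sqrtr0.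
by apply: cvg_trans; apply: near_eq_cvg; near=> k; rewrite /= sqrtr_sqr ger0_norm.
Unshelve. all: by end_near. Qed.

Theorem lemma3p1 (R : realType) (n : nat) (f : 'cV[R]_n -> R)
  (x0 : 'cV[R]_n) (dmax kLg : R)
  (dmax_gt0 : 0 < dmax)
  (f_C1 : exists U : set 'cV[R]_n,
    [/\ open U, enlarged_level_set f x0 dmax `<=` U & C1_on f U])
  (f_lip : elipschitz_on (gradient f) (enlarged_level_set f x0 dmax) kLg)
  (f_bdd : has_lbound (f @` level_set f x0))
  (eta1 eta2 gamma delta0 kfcd kbhm : R)
  (eta1_gt0 : 0 < eta1) (eta2_gt0 : 0 < eta2) (gamma_gt1 : 1 < gamma)
  (delta0_gt0 : 0 < delta0) (delta0_le : delta0 <= dmax)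
  (kfcd_gt0 : 0 < kfcd) (kfcd_le1 : kfcd <= 1) (kbhm_gt0 : 0 < kbhm)
  (m : nat -> 'cV[R]_n -> R) (x : nat -> 'cV[R]_n) (delta : nat -> R)
  (s : nat -> 'cV[R]_n)
  (run : trust_region_run f eta1 eta2 gamma dmax kfcd x0 delta0 m x delta s)
  (hess_bdd : forall k, opnorm (hessian (m k) (x k)) <= kbhm) :
  delta @ \oo --> (0 : R).
Proof.
case: run => x0E d0E _ _ decr nextx nextd.
pose ok k := successful eta1 eta2 f (m k) (x k) (delta k) (s k).
have gamma_gt0 : 0 < gamma by apply: lt_trans gamma_gt1.
have d_gt0 k : 0 < delta k.
  elim: k => [|k IH]; first by rewrite d0E.
  rewrite nextd; case: ifP => _; first by rewrite lt_min mulr_gt0.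
  by rewrite mulr_gt0 // invr_gt0.
pose c := eta1 * (kfcd / 2 * eta2 * Num.min (eta2 / kbhm) 1).
have c_gt0 : 0 < c.
  by rewrite /c !mulr_gt0 ?invr_gt0 // lt_min ltr01 divr_gt0.
have f_drop k : ok k -> c * delta k ^+ 2 <= f (x k) - f (x k.+1).
  move=> okk; rewrite nextx -/(ok k) okk.
  exact: (@successful_decrease _ _ f (m k)).
have f_stay k : ok k = false -> x k.+1 = x k.
  by rewrite nextx -/(ok k) => ->.
have f_le k : f (x k) <= f x0.
  elim: k => [|k]; first by rewrite x0E.
  apply: le_trans; case okk: (ok k); last by rewrite f_stay.
  by rewrite -subr_ge0 (le_trans _ (f_drop _ okk)) // mulr_ge0 ?sqr_ge0 ?ltW.
case: f_bdd => M f_geM.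
have f_ge k : M <= f (x k) by apply: f_geM; exists (x k) => //; exact: f_le.
(* With the weight [a] the radius can add at most
   [(gamma ^+ 2 - 1) * a * delta k ^+ 2 = (c - a) * delta k ^+ 2]. *)
pose a := c / gamma ^+ 2.
have a_gt0 : 0 < a by rewrite divr_gt0 ?exprn_gt0.
pose b := 1 - gamma^-1 ^+ 2.
have b_gt0 : 0 < b.
  by rewrite subr_gt0 expr_lt1 ?invr_ge0 ?invf_lt1 // ltW.
have b_le1 : b <= 1 by rewrite gerBl sqr_ge0.
apply: (@cvg0_of_potential _ (fun k => f (x k) + a * delta k ^+ 2) delta
         (a * b) M).
- exact: mulr_gt0.
- by move=> k; exact/ltW.
- by move=> k; rewrite (le_trans (f_ge k)) // lerDl mulr_ge0 ?sqr_ge0 // ltW.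
move=> k; case okk: (ok k); last first.
  rewrite f_stay // nextd -/(ok k) okk exprMn /b le_eqVlt; apply/orP; left.
  by apply/eqP; ring.
have growth : a * delta k.+1 ^+ 2 <= c * delta k ^+ 2.
  have -> : c * delta k ^+ 2 = a * (gamma * delta k) ^+ 2.
    by rewrite exprMn [RHS]mulrA divfK // expf_neq0 // gt_eqF.
  rewrite ler_wpM2l ?(ltW a_gt0) // lerXn2r ?nnegrE ?mulr_ge0 ?(ltW (d_gt0 _)) //.
    exact: ltW.
  by rewrite nextd -/(ok k) okk ge_min lexx.
have : a * b * delta k ^+ 2 <= a * delta k ^+ 2.
  by rewrite ler_wpM2r ?sqr_ge0 // ler_piMr // ltW.
by move: growth (f_drop _ okk); lra.
Qed.
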